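(* Let $f\colon [0,1]^d \to \mathbb{R}$ be a non-constant continuous function, and let $a \in \mathbb{R}$ be any level such that $\min_{x \in [0,1]^d} f(x) < a < \max_{x \in [0,1]^d} f(x)$. Then there exists $\kappa>0$ such that, for all $\varepsilon>0$, \[ \mathcal{N}\bigl(\{f=a\},\, \varepsilon\bigr) \ge \kappa\, \frac{1}{\varepsilon^{d-1}} . \]
   Context: Here $d\ge 1$ is an integer and $\{f=a\} := \{x\in[0,1]^d : f(x)=a\}$. For $r>0$ and $E\subseteq [0,1]^d$, the $r$-packing number $\mathcal{N}(E,r)$ (with respect to the sup-norm $\|\cdot\|_\infty$) is $\mathcal{N}(E,r) := \sup\{ k\in\{1,2,\dots\} : \exists\, x_1,\dots,x_k\in E,\ \min_{i\ne j}\|x_i-x_j\|_\infty > r\}$ if $E$ is nonempty, and $0$ if $E$ is empty. *)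

(* Defs.v *)
From HB Require Import structures.
From mathcomp Require Import all_boot all_order all_algebra.
From mathcomp Require Import all_classical all_reals all_analysis.

Set Implicit Arguments.
Unset Strict Implicit.
Unset Printing Implicit Defensive.

Import Order.TTheory GRing.Theory Num.Theory.
Import numFieldNormedType.Exports.

Local Open Scope classical_set_scope.
Local Open Scope ring_scope.

Definition unit_cube (R : realType) (d : nat) : set 'rV[R]_d :=
  [set x | forall i : 'I_d, 0 <= x ord0 i <= 1].
Arguments unit_cube : clear implicits.

(* A function on the cube is represented by a total function on 'rV[R]_d of
   which only the values on the cube are ever used. *)
Definition level_set (R : realType) (d : nat) (f : 'rV[R]_d -> R) (a : R) :
    set 'rV[R]_d :=
  [set x | unit_cube R d x /\ f x = a].

Definition is_min_on (T : Type) (R : realType) (A : set T) (f : T -> R)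
    (m : R) : Prop :=
  (f @` A) m /\ lbound (f @` A) m.

Definition is_max_on (T : Type) (R : realType) (A : set T) (f : T -> R)
    (M : R) : Prop :=
  (f @` A) M /\ ubound (f @` A) M.

(* The library norm on matrices, hence on 'rV[R]_d, is the sup-norm. For k = 1
   the separation condition is vacuous (the minimum over no pairs is +oo). *)
Definition has_packing (R : realType) (d : nat) (E : set 'rV[R]_d) (r : R)
    (k : nat) : Prop :=
  exists x : 'I_k -> 'rV[R]_d,
    (forall i, E (x i)) /\ (forall i j, i != j -> r < `|x i - x j|).

(* Extended-real valued: the supremum is +oo when E contains arbitrarily large
   packings. The empty case is separate because ereal_sup set0 = -oo. *)
Definition packing_number (R : realType) (d : nat) (E : set 'rV[R]_d) (r : R) :
    \bar R :=
  if `[< E !=set0 >] then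
    ereal_sup [set (k%:R)%:E | k in [set k : nat | (0 < k)%N /\ has_packing E r k]]
  else 0%E.

(* Main.v *)
Require Import Defs.
From HB Require Import structures.
From mathcomp Require Import all_boot all_order all_algebra.
From mathcomp Require Import all_classical all_reals all_analysis.
From mathcomp Require Import lra.

Set Implicit Arguments.
Unset Strict Implicit.
Unset Printing Implicit Defensive.

Import Order.TTheory GRing.Theory Num.Theory.
Import numFieldNormedType.Exports.

Local Open Scope classical_set_scope.
Local Open Scope ring_scope.

(** Pick [u], [v] in the cube with [f u < a < f v].  For a small [s], every
    homothetic segment from [(1 - s) u + s y] to [(1 - s) v + s y], with [y] in
    the cube, stays in the cube and still crosses the level [a].  Let [i] be a
    coordinate maximizing [|v_i - u_i|], and let [y] range over a grid in the
    facet [y_i = 0] with [s y] of step [3 eps].  If two points on such segments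
    are [eps]-close, their [i]-th coordinates bound by [eps] the displacement
    along [v - u] in every coordinate, so [s y] and [s y'] are [2 eps]-close
    and the grid points agree.  There are about [(s / 3 eps)^(d-1)] segments. *)

Lemma coord_le_norm (R : realType) (d : nat) (x : 'rV[R]_d) (j : 'I_d) :
  `|x ord0 j| <= `|x|.
Proof.
rewrite [leRHS]/Num.norm /= mx_normrE.
exact: (le_bigmax _ (fun ij : 'I_1 * 'I_d => `|x ij.1 ij.2|) (ord0, j)).
Qed.

Lemma norm_row_le (R : realType) (d : nat) (x : 'rV[R]_d) (c : R) :
  0 <= c -> (forall j, `|x ord0 j| <= c) -> `|x| <= c.
Proof.
move=> c0 xc; rewrite [leLHS]/Num.norm /= mx_normrE.
by apply: bigmax_le => // -[i j] _ /=; rewrite (ord1 i).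
Qed.

Lemma unit_cube_convex (R : realType) (d : nat) (x y : 'rV[R]_d) (s : R) :
  0 <= s <= 1 -> unit_cube R d x -> unit_cube R d y ->
  unit_cube R d ((1 - s) *: x + s *: y).
Proof.
move=> s01 hx hy i; rewrite !mxE; have := hx i; have := hy i; nra.
Qed.

(** Two points of the cube differ by at most 1 in each coordinate, so the homothetic image of [y]
    lies within [s] of [u]. Hence the radius of a ball around [u] serves as [e], uniformly in
    [y]. *)
Lemma near_cube_homothety (R : realType) (d : nat) (u : 'rV[R]_d)
    (P : set 'rV[R]_d) :
  unit_cube R d u -> (\forall x \near within (unit_cube R d) (nbhs u), P x) ->
  exists2 e : R, 0 < e & forall s y, 0 <= s <= 1 -> s < e ->
    unit_cube R d y -> P ((1 - s) *: u + s *: y).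
Proof.
move=> hu; rewrite near_withinE => /nbhs_ballP[e /= e0 ball_P].
exists e => // s y s01 se hy; apply: ball_P; last exact: unit_cube_convex.
rewrite -ball_normE /=; apply: le_lt_trans se.
apply: norm_row_le => [|j]; first by case/andP: s01.
rewrite !mxE; have := hu j; have := hy j; rewrite ler_norml; nra.
Qed.

(** Intermediate value theorem for [f] along the segment. Continuity of [f] within the cube
    transfers to [[0, 1]] because convexity keeps the segment in the cube. *)
Lemma segment_meets_level (R : realType) (d : nat) (f : 'rV[R]_d -> R)
    (a : R) (x y : 'rV[R]_d) :
  {within unit_cube R d, continuous f} ->
  unit_cube R d x -> unit_cube R d y -> f x <= a -> a <= f y ->
  exists t : R, level_set f a ((1 - t) *: x + t *: y).
Proof.
move=> /subspace_continuousP f_cont hx hy fx fy.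
pose g (t : R) := (1 - t) *: x + t *: y.
have g_cont : continuous g.
  move=> t; apply: (@cvgD _ 'rV[R]_d).
    by apply: (@cvgZ R 'rV[R]_d); [apply: (@cvgB _ R^o); [exact: cvg_cst|exact: cvg_id]|exact: cvg_cst].
  by apply: (@cvgZ R 'rV[R]_d); [exact: cvg_id|exact: cvg_cst].
have g_cube t : 0 <= t <= 1 -> unit_cube R d (g t).
  by move=> t01; exact: unit_cube_convex.
have fg_cont : {within `[0, 1], continuous (f \o g)}.
  apply/subspace_continuousP => t; rewrite /= in_itv /= => t01.
  apply: (@cvg_comp _ _ _ g f _ _ _ _ (f_cont _ (g_cube _ t01))) => A.
  rewrite /within /= => /g_cont; apply: (@filterS _ (nbhs t)) => r gA r01.
  by apply: gA; apply: g_cube; move: r01; rewrite /= in_itv.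
have g0 : g 0 = x by rewrite /g subr0 scale1r scale0r addr0.
have g1 : g 1 = y by rewrite /g subrr scale1r scale0r add0r.
have [|t] := IVT (v := a) ler01 fg_cont.
  by rewrite /= g0 g1 ge_min le_max fx fy orbT.
by rewrite in_itv /= => t01 fgt; exists t; split => //; exact: g_cube.
Qed.

(** Allows the points to be indexed directly by grid functions. *)
Lemma has_packing_card (R : realType) (d : nat) (E : set 'rV[R]_d) (r : R)
    (I : finType) (x : I -> 'rV[R]_d) :
  (forall i, E (x i)) -> (forall i j, i != j -> r < `|x i - x j|) ->
  has_packing E r #|I|.
Proof.
move=> Ex sep; exists (x \o enum_val); split=> [i|i j ij]; first exact: Ex.
by apply: sep; rewrite (inj_eq enum_val_inj).
Qed.

Lemma has_packing_le (R : realType) (d : nat) (E : set 'rV[R]_d) (r : R)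
    (k : nat) :
  (0 < k)%N -> has_packing E r k -> ((k%:R)%:E <= packing_number E r)%E.
Proof.
move=> k0 pack; rewrite /packing_number asboolT.
  by apply: ereal_sup_ubound; exists k.
by case: pack => x [Ex _]; exists (x (Ordinal k0)).
Qed.

(** The parameters [t] and [t'] are arbitrary, since the crossing points are known only to exist. *)
Lemma segments_separated (R : realType) (d : nat) (u v y y' : 'rV[R]_d)
    (s t t' eps : R) (i j : 'I_d) :
  (forall k, `|v ord0 k - u ord0 k| <= `|v ord0 i - u ord0 i|) ->
  y ord0 i = y' ord0 i ->
  2 * eps < `|s * (y ord0 j - y' ord0 j)| ->
  eps < `|((1 - t) *: ((1 - s) *: u + s *: y)
           + t *: ((1 - s) *: v + s *: y))
        - ((1 - t') *: ((1 - s) *: u + s *: y')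
           + t' *: ((1 - s) *: v + s *: y'))|.
Proof.
move=> vu_max yi yj; rewrite ltNge; apply/negP => close.
set z := _ - _ in close.
(* A displacement along [v - u] plus the scaled difference of grid points; the latter vanishes at
   [i]. *)
have zE k : z ord0 k = (1 - s) * (t - t') * (v ord0 k - u ord0 k)
                       + s * (y ord0 k - y' ord0 k).
  by rewrite !mxE; lra.
have zi : `|(1 - s) * (t - t') * (v ord0 i - u ord0 i)| <= eps.
  have := le_trans (coord_le_norm z i) close.
  by rewrite zE yi subrr mulr0 addr0.
have zj : `|(1 - s) * (t - t') * (v ord0 j - u ord0 j)| <= eps.
  by apply: le_trans zi; rewrite !normrM ler_wpM2l.
have := le_trans (coord_le_norm z j) close; rewrite zE.
set A := _ * (v _ _ - _) in zj *; set B := s * _ in yj * => zAB.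
(* Both [A + B] and [A] are at most [eps] in absolute value, so [B] is at most [2 * eps]. *)
have := ler_normB (A + B) A; rewrite [A + B]addrC addrK [B + A]addrC; lra.
Qed.

Theorem theorem1 (R : realType) (d : nat) (hd : (1 <= d)%N)
    (f : 'rV[R]_d -> R)
    (f_cont : {within unit_cube R d, continuous f})
    (f_nonconst : ~ exists c : R, forall x, unit_cube R d x -> f x = c)
    (m M : R)
    (hm : is_min_on (unit_cube R d) f m)
    (hM : is_max_on (unit_cube R d) f M)
    (a : R) (hma : m < a) (haM : a < M) :
  exists kappa : R, 0 < kappa /\
    forall eps : R, 0 < eps ->
      ((kappa * (1 / eps ^+ (d - 1)))%:E
         <= packing_number (level_set f a) eps)%E.
Proof.
case: hm => -[u hu fu] _; case: hM => -[v hv fv] _; subst m M.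
clear f_nonconst; case: d hd f f_cont u hu v hv hma haM => // n _ f f_cont.
move=> u hu v hv fua afv.
have /subspace_continuousP fc := f_cont.
have [e1 e1_gt0 below] := near_cube_homothety hu (cvgr_lt _ (fc u hu) _ fua).
have [e2 e2_gt0 above] := near_cube_homothety hv (cvgr_gt _ (fc v hv) _ afv).
have [s [s_gt0 s_le1 se1 se2]] : exists s : R, [/\ 0 < s, s <= 1, s < e1 & s < e2].
  (* Halving makes the bounds by [e1] and [e2] strict. *)
  exists (Num.min 1 (Num.min e1 e2) / 2).
  have : 0 < Num.min 1 (Num.min e1 e2) by rewrite !lt_min ltr01 e1_gt0.
  have : Num.min 1 (Num.min e1 e2) <= 1 by rewrite ge_min lexx.
  have : Num.min 1 (Num.min e1 e2) <= e1 by rewrite !ge_min lexx orbT.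
  have : Num.min 1 (Num.min e1 e2) <= e2 by rewrite !ge_min lexx !orbT.
  by split; lra.
have s01 : 0 <= s <= 1 by rewrite ltW.
have [i vu_max] : exists i, forall k,
    `|v ord0 k - u ord0 k| <= `|v ord0 i - u ord0 i|.
  case: (arg_maxP (fun k => `|v ord0 k - u ord0 k|) (isT : xpredT (ord0 : 'I_n.+1))).
  by move=> i _ i_max; exists i => k; exact: i_max.
(* The grid below has [(N + 1) ^ n] points, with [N + 1 > s / (3 * eps)]. *)
exists ((s / 3) ^+ n); split=> [|eps eps_gt0]; first by rewrite exprn_gt0 ?divr_gt0.
rewrite subn1 /= div1r -expr_div_n.
pose N := Num.truncn (s / 3 / eps).
have q_ge0 : 0 <= s / 3 / eps by rewrite !divr_ge0 ?ltW.
have N_le : N%:R * (3 * eps) <= s.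
  have : N%:R <= s / 3 / eps by rewrite truncn_le.
  by rewrite ler_pdivlMr // ler_pdivlMr //; lra.
(* Coordinate [i] is 0 and [g] fills the other [n]. For large [eps], [N] is 0 and each of them takes
   only the value 0. *)
pose y (g : {ffun 'I_n -> 'I_N.+1}) : 'rV[R]_n.+1 :=
  \row_k (if unlift i k is Some k' then (g k' : nat)%:R * (3 * eps) / s else 0).
have y_cube g : unit_cube R n.+1 (y g).
  move=> k; rewrite mxE; case: unliftP => [k' _|_]; last by rewrite lexx ler01.
  rewrite ler_pdivrMr // mul1r divr_ge0 ?mulr_ge0 ?(ltW s_gt0) ?(ltW eps_gt0) //=.
  apply: le_trans N_le; rewrite ler_wpM2r ?mulr_ge0 ?(ltW eps_gt0) //.
  by rewrite ler_nat -ltnS.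
have /choice[t t_level] g : exists t : R, level_set f a
    ((1 - t) *: ((1 - s) *: u + s *: y g) + t *: ((1 - s) *: v + s *: y g)).
  apply: segment_meets_level => //; try exact: unit_cube_convex.
    exact/ltW/below.
  exact/ltW/above.
have pack : has_packing (level_set f a) eps #|{ffun 'I_n -> 'I_N.+1}|.
  apply: (has_packing_card t_level) => g g' gg'.
  have [k gk] : exists k, g k != g' k.
    apply/existsP; apply: contraNT gg'; rewrite negb_exists => /forallP gg'.
    by apply/eqP/ffunP => k; apply/eqP; have := gg' k; rewrite negbK.
  apply: (@segments_separated _ _ _ _ _ _ _ _ _ _ i (lift i k)) => //.
    by rewrite !mxE unlift_none.
  rewrite !mxE !liftK -!mulrBl [X in `|X|]mulrC divfK ?gt_eqF // normrM.
  rewrite [`|3 * eps|]gtr0_norm ?mulr_gt0 //.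
  (* Distinct naturals differ by at least 1, so the gap is at least [3 * eps], which exceeds
     [2 * eps]. *)
  have : 1 <= `|(g k : nat)%:R - (g' k : nat)%:R : R|.
    rewrite ler_normr; move: gk; rewrite -val_eqE neq_ltn.
    by case/orP; rewrite -(ler_nat R) -natr1 => gk; apply/orP; [right|left]; lra.
  by nra.
apply: le_trans (has_packing_le _ pack).
  rewrite lee_fin card_ffun !card_ord natrX lerXn2r ?nnegrE //.
  exact/ltW/truncnS_gt.
by rewrite card_ffun !card_ord expn_gt0.
Qed.
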